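(* Let $0<p<q<1$ and let $n>1$ be an integer. Then $$\text{(a)}\quad \frac{(p;p)_\infty^n}{(p^{\frac1n};p^{\frac1n})_\infty}(1-p)^{\frac{n-1}{2}}\leq\frac{(q;q)_\infty^n}{(q^{\frac1n};q^{\frac1n})_\infty}(1-q)^{\frac{n-1}{2}}\leq\frac{(2\pi)^{\frac{n-1}{2}}}{\sqrt n},$$ $$\text{(b)}\quad \frac{(p;p)_\infty^n}{(p;p^{\frac1n})_\infty}\frac{1}{(1-p)^{\frac{n-1}{2}}}\geq\frac{(q;q)_\infty^n}{(q;q^{\frac1n})_\infty}\frac{1}{(1-q)^{\frac{n-1}{2}}}\geq\frac{(n-1)!\,(2\pi)^{\frac{n-1}{2}}}{n^{n-\frac12}}.$$
   Context: For a base $r\in(0,1)$ and complex $a$, $(a;r)_\infty=\prod_{i=0}^{\infty}(1-ar^i)$, and $(a;r)_\infty^{n}$ means $\big((a;r)_\infty\big)^n$. *)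

(* Defs.v *)
From HB Require Import structures.
From mathcomp Require Import all_boot all_order all_algebra.
From mathcomp Require Import all_classical all_reals all_analysis.
Set Implicit Arguments.
Unset Strict Implicit.
Unset Printing Implicit Defensive.
Import Order.TTheory GRing.Theory Num.Theory.
Import numFieldNormedType.Exports.
Local Open Scope classical_set_scope.
Local Open Scope ring_scope.

(* The infinite product (a; r)_oo.  The field K is generic so that a may be
   real or complex; over either field the partial products converge whenever
   `|r| < 1, so the default value of limn is never reached there. *)
Definition qpochhammer (K : numFieldType) (a r : K) : K :=
  limn (fun N : nat => \prod_(0 <= i < N) (1 - a * r ^+ i)).

(* Main.v *)
Require Import Defs.
From HB Require Import structures.
From mathcomp Require Import all_boot all_order all_algebra.
From mathcomp Require Import all_classical all_reals all_analysis.
From mathcomp Require Import ring lra.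
Set Implicit Arguments.
Unset Strict Implicit.
Unset Printing Implicit Defensive.
Import Order.TTheory GRing.Theory Num.Theory.
Import numFieldNormedType.Exports.
Local Open Scope ring_scope.

(** Both expressions are products of q-Gamma values.  With
      [Gamma_q x = (q; q) / (q^x; q) * (1 - q)^(1 - x)],
    splitting the product of base [q^(1/n)] into [n] products of base [q] shows
    that (a) is about the product of [Gamma_q (k / n)] over [1 <= k <= n], and
    (b) about the product of [Gamma_q (1 + k / n)] over [0 <= k < n].  The claim
    is thus that [Gamma_q x] increases with [q] to [Gamma x] for [x <= 1], and
    decreases to it for [1 <= x <= 2]; the constants are Gauss's multiplication
    formula.

    The monotonicity is Askey's argument.  [ln Gamma_r - ln Gamma_q] vanishes at
    [x = 1] and [x = 2], and it is convex in [x] when [q < r], because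
    [u |-> ln (1 - q^u) - ln (1 - r^u)] is convex on the open half-line.  The
    second derivative of [- ln (1 - q^u)] is the square of
    [(L / 2) / sinh (L u / 2)] with [L = - ln q], so this convexity is the fact
    that [sinh z / z] increases; that this quotient is at least 1 gives the
    convexity of [ln (1 - q^u) - ln u], which is the limit case [r = 1].

    The argument already works for the product truncated after [N] factors,
    whose logarithm is [euler_ln f N x] for a log-weight [f]: it takes
    [f u = ln (1 - q^u)] for [Gamma_q], and [f u = ln u] for Euler's product for
    [Gamma].  The truncated logarithm of a convex [D] is at most 0 for [x <= 1]
    ([euler_ln_le0]) and at least 0 for [1 <= x <= 2] ([euler_ln_ge0]), since
    the slopes of [D] telescope.  All four inequalities therefore hold at each
    finite [N], and one lets [N] tend to infinity on both sides.

    For [f u = ln (1 - q^u)] the limit is read off from the convergence of the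
    infinite products to positive values ([cvg_euler_ln_weight_grid]).  For
    [f = ln] the truncated product is made of [N!^n] and [(n N)!], so Stirling's
    formula gives the limit ([cvg_euler_ln_ln_grid]), and Wallis's product
    identifies Stirling's constant ([cvg_stirling_error]). *)

(** * Monotonicity from derivatives and the hyperbolic sine *)

Lemma ge0_is_derive_le {R : realType} (f df : R -> R) (a b : R) :
  a <= b -> (forall x, a <= x <= b -> is_derive x 1 f (df x)) ->
  (forall x, a <= x <= b -> 0 <= df x) -> f a <= f b.
Proof.
move=> ab fd df0.
have [||c + fE] := @MVT_segment R f df a b ab.
- by move=> x; rewrite in_itv /= => /andP[ax xb]; apply: fd; rewrite !ltW.
- apply: derivable_within_continuous => x; rewrite in_itv /= => xab.
  by apply: ex_derive; exact: fd.
- rewrite in_itv /= => cab.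
  by rewrite -subr_ge0 fE mulr_ge0 ?subr_ge0 ?df0.
Qed.

Lemma ler_cosh {R : realType} (s t : R) : 0 <= s -> s <= t ->
  expR s + expR (- s) <= expR t + expR (- t).
Proof.
move=> s0 st; rewrite !expRN.
have es : 1 <= expR s by rewrite -expR0 ler_expR.
have et : expR s <= expR t by rewrite ler_expR.
have -> : expR t + (expR t)^-1 = expR s + (expR s)^-1 +
    (expR t - expR s) * (1 - (expR s * expR t)^-1).
  by field; rewrite !expR_eq0.
rewrite lerDl mulr_ge0 ?subr_ge0 // invf_le1 ?mulr_gt0 ?expR_gt0 //.
by rewrite mulr_ege1 // (le_trans es).
Qed.

Lemma sinh_ratio_le {R : realType} (s t : R) : 0 <= s -> s <= t ->
  t * (expR s - expR (- s)) <= s * (expR t - expR (- t)).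
Proof.
move=> s0 st; rewrite -subr_ge0.
(* [F] has derivative [2 s t (cosh (t z) - cosh (s z)) >= 0]. *)
pose F z := s * (expR (t * z) - expR (- (t * z)))
          - t * (expR (s * z) - expR (- (s * z))).
have <- : F 0 = 0 by rewrite /F !mulr0 oppr0 expR0 !subrr !mulr0 subrr.
have -> : s * (expR t - expR (- t)) - t * (expR s - expR (- s)) = F 1.
  by rewrite /F !mulr1.
pose dF z := s * t * ((expR (t * z) + expR (- (t * z)))
          - (expR (s * z) + expR (- (s * z)))).
apply: (@ge0_is_derive_le R F dF) => // z /andP[z0 _].
  rewrite /F; apply: is_derive_eq; rewrite /dF /GRing.scale /=; ring.
rewrite /dF mulr_ge0 //; first by rewrite mulr_ge0 // (le_trans s0).
by rewrite subr_ge0 ler_cosh ?mulr_ge0 // ler_wpM2r.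
Qed.

Lemma sinh_ge_id {R : realType} (s : R) : 0 <= s ->
  2 * s <= expR s - expR (- s).
Proof.
move=> s0; rewrite -subr_ge0.
pose F z : R := expR z - expR (- z) - 2 * z.
have <- : F 0 = 0 by rewrite /F mulr0 oppr0 expR0 subrr addr0.
apply: (@ge0_is_derive_le R F (fun z => expR z + expR (- z) - 2)) => // z.
  move=> _; rewrite /F; apply: is_derive_eq; rewrite /GRing.scale /=; ring.
move=> /andP[z0 _]; rewrite subr_ge0.
by have := @ler_cosh R 0 z (lexx 0) z0; rewrite oppr0 expR0.
Qed.

(** * Convexity of differences of log-weights *)

(** Monotonicity of the slopes of a convex function on the open half-line,
    multiplied out so that [a = b] and [b = c] are harmless. *)
Definition chord_convex {R : realType} (D : R -> R) : Prop :=
  forall a b c : R, 0 < a -> a <= b -> b <= c ->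
    (c - b) * (D b - D a) <= (b - a) * (D c - D b).

Lemma second_derivative_chord_convex {R : realType} (D D1 D2 : R -> R) :
  (forall u : R, 0 < u -> is_derive u 1 D (D1 u)) ->
  (forall u : R, 0 < u -> is_derive u 1 D1 (D2 u)) ->
  (forall u : R, 0 < u -> 0 <= D2 u) -> chord_convex D.
Proof.
move=> dD dD1 D2ge0 a b c a0 ab bc.
have mvt x y : 0 < x -> x <= y ->
    exists2 z, x <= z <= y & D y - D x = D1 z * (y - x).
  move=> x0 xy; have [||z zxy DE] := @MVT_segment R D D1 x y xy.
  - move=> z; rewrite in_itv /= => /andP[xz _].
    by apply: dD; exact: lt_trans xz.
  - apply: derivable_within_continuous => z; rewrite in_itv /= => /andP[xz _].
    by apply: ex_derive; apply: dD; exact: lt_le_trans xz.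
  - by exists z => //; move: zxy; rewrite in_itv.
have [v /andP[av vb] ->] := mvt a b a0 ab.
have [w /andP[bw wc] ->] := mvt b c (lt_le_trans a0 ab) bc.
have -> : (c - b) * (D1 v * (b - a)) = (c - b) * (b - a) * D1 v by ring.
have -> : (b - a) * (D1 w * (c - b)) = (c - b) * (b - a) * D1 w by ring.
apply: ler_wpM2l; first by rewrite mulr_ge0 // subr_ge0.
apply: (@ge0_is_derive_le _ D1 D2); first exact: le_trans bw.
- by move=> z /andP[vz _]; apply: dD1; rewrite (lt_le_trans a0) ?(le_trans av).
- move=> z /andP[vz _]; apply: D2ge0.
  by rewrite (lt_le_trans a0) ?(le_trans av).
Qed.

Section LogWeight.
Context {R : realType}.
Implicit Types (q u : R).

Definition ln_weight (q u : R) : R := ln (1 - q `^ u).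

Lemma powR_lt1 q u : 0 < q -> q < 1 -> 0 < u -> q `^ u < 1.
Proof.
move=> q0 q1 u0; rewrite /powR gt_eqF // expR_lt1 pmulr_rlt0 //.
by rewrite ln_lt0 // q0.
Qed.

Lemma is_derive_ln_weight q u : 0 < q -> q < 1 -> 0 < u ->
  is_derive u 1 (ln_weight q) (- ln q * q `^ u / (1 - q `^ u)).
Proof.
move=> q0 q1 u0; have w0 : 0 < 1 - q `^ u by rewrite subr_gt0 powR_lt1.
have -> : ln_weight q = @ln R \o (fun v => 1 - expR (v * ln q)).
  by apply/funext => v; rewrite /ln_weight /powR gt_eqF.
have E : q `^ u = expR (u * ln q) by rewrite /powR gt_eqF.
rewrite E in w0 *.
have dln := @is_derive1_ln R _ w0.
have dw : is_derive u 1 (fun v => 1 - expR (v * ln q))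
    (- (ln q * expR (u * ln q))).
  by apply: is_derive_eq; rewrite /GRing.scale /=; ring.
apply: is_derive_eq; rewrite /GRing.scale /=; field.
by rewrite gt_eqF.
Qed.

Lemma is_derive_ln_weight2 q u : 0 < q -> q < 1 -> 0 < u ->
  is_derive u 1 (fun v => - ln q * q `^ v / (1 - q `^ v))
    (- (ln q ^+ 2 * q `^ u / (1 - q `^ u) ^+ 2)).
Proof.
move=> q0 q1 u0; have w0 : 0 < 1 - q `^ u by rewrite subr_gt0 powR_lt1.
have powE v : q `^ v = expR (v * ln q) by rewrite /powR gt_eqF.
have -> : (fun v => - ln q * q `^ v / (1 - q `^ v)) =
    (fun v => - ln q * expR (v * ln q) * (1 - expR (v * ln q))^-1).
  by apply/funext => v; rewrite powE.
rewrite powE in w0 *.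
have wN0 : 1 - expR (u * ln q) != 0 by rewrite gt_eqF.
have dw : is_derive u 1 (fun v => 1 - expR (v * ln q))
    (- (ln q * expR (u * ln q))).
  by apply: is_derive_eq; rewrite /GRing.scale /=; ring.
have dV := @is_deriveV R (fun v => 1 - expR (v * ln q)) u _ 1 wN0 dw.
have dn : is_derive u 1 (fun v => - ln q * expR (v * ln q))
    (- ln q ^+ 2 * expR (u * ln q)).
  by apply: is_derive_eq; rewrite /GRing.scale /=; ring.
apply: is_derive_eq; rewrite /GRing.scale /=; field.
by [].
Qed.

(** Turns the convexity of differences of log-weights into a comparison of
    hyperbolic sines. *)
Lemma curvature_sinhE q u : 0 < q -> q < 1 -> 0 < u ->
  ln q ^+ 2 * q `^ u / (1 - q `^ u) ^+ 2 =
  (- ln q / (expR (- ln q * u / 2) - expR (- (- ln q * u / 2)))) ^+ 2.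
Proof.
move=> q0 q1 u0; have w0 : 0 < 1 - q `^ u by rewrite subr_gt0 powR_lt1.
have wE : q `^ u = expR (- (- ln q * u / 2)) ^+ 2.
  by rewrite /powR gt_eqF // -expRM_natl; congr expR; field.
rewrite wE in w0 *; move: w0; rewrite !expRN.
have e0 := expR_gt0 (- ln q * u / 2).
move: e0; set e := expR _ => e0; rewrite subr_gt0 => we.
have e1 : e ^+ 2 - 1 != 0.
  rewrite subr_eq0 gt_eqF //; move: we; rewrite exprVn invf_lt1 //.
  by rewrite exprn_gt0.
by field; rewrite e1 gt_eqF.
Qed.

Lemma sinh_Nln_gt0 q u : 0 < q -> q < 1 -> 0 < u ->
  0 < expR (- ln q * u / 2) - expR (- (- ln q * u / 2)).
Proof.
move=> q0 q1 u0; rewrite subr_gt0 ltr_expR gtrN ?divr_gt0 ?mulr_gt0 //.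
by rewrite oppr_gt0 ln_lt0 // q0.
Qed.

(** With [L = - ln q], the function [L / sinh (L u / 2)] decreases when [L]
    grows, as [sinh z / z] increases. *)
Lemma ln_weightB_chord_convex p q : 0 < p -> p < q -> q < 1 ->
  chord_convex (fun u => ln_weight p u - ln_weight q u).
Proof.
move=> p0 pq q1; have q0 := lt_trans p0 pq; have p1 := lt_trans pq q1.
have lq : 0 < - ln q by rewrite oppr_gt0 ln_lt0 // q0.
have lpq : - ln q <= - ln p by rewrite lerN2 ler_ln ?ltW.
pose D1 (r u : R) := - ln r * r `^ u / (1 - r `^ u).
pose D2 (r u : R) := ln r ^+ 2 * r `^ u / (1 - r `^ u) ^+ 2.
apply: (@second_derivative_chord_convex _ _
    (fun u => D1 p u - D1 q u) (fun u => D2 q u - D2 p u)) => u u0.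
- have := is_derive_ln_weight p0 p1 u0; have := is_derive_ln_weight q0 q1 u0.
  by move=> ? ?; apply: is_derive_eq.
- have := is_derive_ln_weight2 p0 p1 u0; have := is_derive_ln_weight2 q0 q1 u0.
  by move=> ? ?; apply: is_derive_eq; rewrite /D2; ring.
have sp := sinh_Nln_gt0 p0 p1 u0; have sq := sinh_Nln_gt0 q0 q1 u0.
rewrite /D2 subr_ge0 !curvature_sinhE // ler_sqr ?nnegrE;
  [|by rewrite divr_ge0 ?(ltW sp) // (le_trans (ltW lq))
   |by rewrite divr_ge0 ?(ltW sq) // (ltW lq)].
have uh : 0 <= u / 2 by rewrite divr_ge0 // ltW.
have s0 : 0 <= - ln q * u / 2 by rewrite -mulrA mulr_ge0 // ltW.
have st : - ln q * u / 2 <= - ln p * u / 2 by rewrite -!mulrA ler_wpM2r.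
have sh_le := sinh_ratio_le s0 st.
rewrite ler_pdivrMr // [leRHS]mulrAC ler_pdivlMr //.
rewrite -(ler_pM2l (divr_gt0 u0 (ltr0Sn R 1))).
by move: sh_le; congr (_ <= _); ring.
Qed.

(** The limit case [q -> 1] of the larger base: [ln u] is the limit of
    [ln (1 - q^u) - ln (1 - q)], and [1 / u] that of
    [(L / 2) / sinh (L u / 2)]. *)
Lemma ln_weightBln_chord_convex q : 0 < q -> q < 1 ->
  chord_convex (fun u => ln_weight q u - ln u).
Proof.
move=> q0 q1; have lq : 0 < - ln q by rewrite oppr_gt0 ln_lt0 // q0.
pose D1 (u : R) := - ln q * q `^ u / (1 - q `^ u).
pose D2 (u : R) := ln q ^+ 2 * q `^ u / (1 - q `^ u) ^+ 2.
apply: (@second_derivative_chord_convex _ _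
    (fun u => D1 u - u^-1) (fun u => u^-1 ^+ 2 - D2 u)) => u u0.
- have := is_derive_ln_weight q0 q1 u0; have := @is_derive1_ln R u u0.
  by move=> ? ?; apply: is_derive_eq.
- have d1 := is_derive_ln_weight2 q0 q1 u0.
  have d2 := @is_deriveV R id u 1 1 (lt0r_neq0 u0) (is_derive_id _ _).
  by apply: is_derive_eq; rewrite /GRing.scale /= mulr1 opprK addrC exprVn.
have sq := sinh_Nln_gt0 q0 q1 u0.
rewrite /D2 subr_ge0 curvature_sinhE // ler_sqr ?nnegrE;
  [|by rewrite divr_ge0 ?(ltW sq) // (ltW lq)|by rewrite invr_ge0 ltW].
have s0 : 0 <= - ln q * u / 2 by rewrite -mulrA mulr_ge0 ?divr_ge0 // ltW.
rewrite ler_pdivrMr // mulrC ler_pdivlMr //.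
by apply: le_trans (sinh_ge_id s0); rewrite mulrCA divff ?mulr1.
Qed.

End LogWeight.

(** * Truncated Euler products *)

Section EulerLog.
Context {R : realType}.
Implicit Types (f g D : R -> R) (q u x c : R) (N n : nat).

(** With [w = exp f], this is the logarithm of
      [(w 1 * ... * w N) / (w x * ... * w (x + N - 1))
        * (w 1 / w (N + 1))^(1 - x)],
    which tends to the q-Gamma function for [w u = 1 - q^u] and to the Gamma
    function for [w u = u].  The last factor makes [euler_ln f N] vanish at
    [x = 1] and at [x = 2] for every [N]. *)
Definition euler_ln f N x : R :=
  \sum_(0 <= i < N) (f i.+1%:R - f (i%:R + x)) + (1 - x) * (f 1 - f N.+1%:R).

Lemma euler_lnB f g N x :
  euler_ln (fun u => f u - g u) N x = euler_ln f N x - euler_ln g N x.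
Proof.
rewrite /euler_ln [in RHS]opprD [RHS]addrACA -sumrB.
congr (_ + _); last by ring.
by apply: eq_bigr => i _; ring.
Qed.

(** [D (i + 1) - D (i + x)] is at most [1 - x] times the slope of [D] over the
    next interval [[i + 1, i + 2]], and these slopes telescope. *)
Lemma euler_ln_le0 D N x : chord_convex D -> 0 < x -> x <= 1 ->
  euler_ln D N x <= 0.
Proof.
move=> cD x0 x1; rewrite /euler_ln; elim: N => [|N IH].
  by rewrite big_geq // subrr mulr0 addr0.
apply: le_trans IH; rewrite big_nat_recr //= -addrA lerD2l.
have := cD (N%:R + x) N.+1%:R N.+2%:R.
have -> : N.+2%:R - N.+1%:R = 1 :> R by rewrite -natr1; ring.
have -> : N.+1%:R - (N%:R + x) = 1 - x by rewrite -natr1; ring.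
have -> : N%:R + x <= N.+1%:R by rewrite -natr1 lerD2l.
rewrite ltr_wpDl // ler_nat leqnSn => /(_ isT isT isT) cc; lra.
Qed.

(** Here [i + x] lies in [[i + 1, i + 2]], so the slope over [[i + 1, i + x]] is
    at most that over the whole interval. *)
Lemma euler_ln_ge0 D N x : chord_convex D -> 1 <= x -> x <= 2 ->
  0 <= euler_ln D N x.
Proof.
move=> cD x1 x2; rewrite /euler_ln; elim: N => [|N IH].
  by rewrite big_geq // subrr mulr0 addr0.
apply: (le_trans IH); rewrite big_nat_recr //= -addrA lerD2l.
have := cD N.+1%:R (N%:R + x) N.+2%:R.
have -> : N.+2%:R - (N%:R + x) = 2 - x by rewrite -!natr1; ring.
have -> : (N%:R + x) - N.+1%:R = x - 1 by rewrite -natr1; ring.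
have -> : N.+1%:R <= N%:R + x by rewrite -natr1 lerD2l.
have -> : N%:R + x <= N.+2%:R by rewrite -!natr1; lra.
rewrite ltr0Sn => /(_ isT isT isT) cc; lra.
Qed.

Lemma sum_natr n : \sum_(0 <= k < n) k%:R = n%:R * (n%:R - 1) / 2 :> R.
Proof.
elim: n => [|n IH]; first by rewrite big_geq // !mul0r.
by rewrite big_nat_recr //= IH -natr1; field.
Qed.

(** Reindexing by [j = i n + k]. *)
Lemma sum_grid f N n c : (0 < n)%N ->
  \sum_(0 <= k < n) \sum_(0 <= i < N) f (i%:R + (c + k%:R / n%:R)) =
  \sum_(0 <= j < n * N) f (c + j%:R / n%:R).
Proof.
move=> n0; rewrite exchange_big_nat /= mulnC big_nat_mul.
apply: eq_bigr => i _.
rewrite -[X in _ = \sum_(X <= _ < _) _]add0n big_addn mulSn addnK.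
apply: eq_bigr => k _; congr f; rewrite natrD natrM mulrDl mulfK; first by ring.
by rewrite pnatr_eq0 -lt0n.
Qed.

(** The offset [c] will be [1 / n] for part (a) and [1] for part (b); the last
    coefficient is the sum of the exponents [1 - x] over the grid, equal to
    [(n - 1) / 2] and [- (n - 1) / 2] respectively. *)
Lemma euler_ln_grid f N n c : (0 < n)%N ->
  \sum_(0 <= k < n) euler_ln f N (c + k%:R / n%:R) =
  n%:R * \sum_(0 <= i < N) f i.+1%:R
  - \sum_(0 <= j < n * N) f (c + j%:R / n%:R)
  + (n%:R * (1 - c) - (n%:R - 1) / 2) * (f 1 - f N.+1%:R).
Proof.
move=> n0; have nN0 : n%:R != 0 :> R by rewrite pnatr_eq0 -lt0n.
rewrite -sum_grid // big_split /= -mulr_suml; congr (_ + _ * _).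
  rewrite exchange_big_nat /= [X in _ - X]exchange_big_nat /= mulr_sumr -sumrB.
  apply: eq_bigr => i _; rewrite sumrB; congr (_ - _).
  by rewrite sumr_const_nat subn0 mulr_natl.
rewrite sumrB sumr_const_nat subn0 big_split /= sumr_const_nat subn0.
rewrite -mulr_suml sum_natr -[c *+ n]mulr_natl; by field.
Qed.

End EulerLog.

(** * Convergence of the infinite products *)

Section QPochhammer.
Context {R : realType}.
Implicit Types (a r q c : R) (N n : nat).

(** A positive lower bound uniform in [N]: it makes the infinite product
    converge to a nonzero value. *)
Lemma prod_qpochhammer_ge a r N : 0 < a -> a < 1 -> 0 < r -> r < 1 ->
  expR (- (a / ((1 - a) * (1 - r)))) <= \prod_(0 <= i < N) (1 - a * r ^+ i).
Proof.
move=> a0 a1 r0 r1; have a'0 : 0 < 1 - a by rewrite subr_gt0.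
have r'0 : 0 < 1 - r by rewrite subr_gt0.
have geomE : \sum_(0 <= i < N) r ^+ i = (1 - r ^+ N) / (1 - r).
  elim: N => [|N IH]; first by rewrite big_geq // expr0 subrr mul0r.
  by rewrite big_nat_recr //= IH exprS; field; rewrite gt_eqF.
apply: (@le_trans _ _ (expR (\sum_(0 <= i < N) - (a / (1 - a) * r ^+ i)))).
  rewrite ler_expR sumrN lerN2 -mulr_sumr geomE invfM [leRHS]mulrA.
  apply: ler_wpM2l; first by rewrite divr_ge0 // ltW.
  by rewrite ler_piMl ?invr_ge0 ?(ltW r'0) // gerBl exprn_ge0 // ltW.
rewrite expR_sum; apply: ler_prod => i _; rewrite expR_ge0 /=.
have x0 : 0 <= a * r ^+ i by rewrite mulr_ge0 ?exprn_ge0 // ltW.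
have xa : a * r ^+ i <= a by rewrite ler_piMr ?exprn_ile1 // ltW.
rewrite mulrAC; set x := a * r ^+ i in x0 xa *.
have y'0 : 0 < 1 - x by lra.
(* [exp (- x / (1 - x)) <= 1 - x] is [1 + y <= exp y] at [y = x / (1 - x)]. *)
apply: (@le_trans _ _ (expR (- (x / (1 - x))))).
  by rewrite ler_expR lerN2 ler_wpM2l // lef_pV2 ?posrE //; lra.
rewrite expRN -[leRHS]invrK lef_pV2 ?posrE ?expR_gt0 ?invr_gt0 //.
apply: le_trans (expR_ge1Dx _); rewrite le_eqVlt; apply/orP; left; apply/eqP.
by field; rewrite gt_eqF.
Qed.

Lemma cvg_prod_qpochhammer a r : 0 < a -> a < 1 -> 0 < r -> r < 1 ->
  ((fun N => \prod_(0 <= i < N) (1 - a * r ^+ i)) @ \oo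
    --> qpochhammer a r)%classic.
Proof.
move=> a0 a1 r0 r1; apply: nonincreasing_is_cvgn.
  apply/nonincreasing_seqP => N; rewrite big_nat_recr //= ler_piMr //.
    by rewrite (le_trans _ (prod_qpochhammer_ge N a0 a1 r0 r1)) // expR_ge0.
  by rewrite gerBl mulr_ge0 ?exprn_ge0 // ltW.
exists (expR (- (a / ((1 - a) * (1 - r))))) => _ [N _ <-].
exact: prod_qpochhammer_ge.
Qed.

Lemma qpochhammer_gt0 a r : 0 < a -> a < 1 -> 0 < r -> r < 1 ->
  0 < qpochhammer a r.
Proof.
move=> a0 a1 r0 r1.
apply: lt_le_trans (expR_gt0 (- (a / ((1 - a) * (1 - r))))) _.
apply: limr_ge; first by apply/cvg_ex; eexists; exact: cvg_prod_qpochhammer.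
by apply: nearW => N; exact: prod_qpochhammer_ge.
Qed.

Lemma cvg_sum_ln_qpochhammer a r : 0 < a -> a < 1 -> 0 < r -> r < 1 ->
  ((fun N => \sum_(0 <= i < N) ln (1 - a * r ^+ i)) @ \oo
    --> ln (qpochhammer a r))%classic.
Proof.
move=> a0 a1 r0 r1.
have -> : (fun N => \sum_(0 <= i < N) ln (1 - a * r ^+ i)) =
    @ln R \o (fun N => \prod_(0 <= i < N) (1 - a * r ^+ i)).
  apply/funext => N /=; rewrite -[LHS]expRK expR_sum; congr ln.
  apply: eq_bigr => i _; rewrite lnK // posrE subr_gt0.
  by rewrite (le_lt_trans _ a1) // ler_piMr ?exprn_ile1 // ltW.
apply: continuous_cvg; last exact: cvg_prod_qpochhammer.
exact/continuous_ln/qpochhammer_gt0.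
Qed.

(** On a grid of step [1 / n] the powers [q^u] form a geometric progression of
    ratio [q^(1/n)]: hence the infinite product with that base. *)
Lemma cvg_euler_ln_weight_grid q n c : 0 < q -> q < 1 -> (0 < n)%N -> 0 < c ->
  ((fun N => \sum_(0 <= k < n) euler_ln (ln_weight q) N (c + k%:R / n%:R)) @ \oo
    --> n%:R * ln (qpochhammer q q) - ln (qpochhammer (q `^ c) (q `^ n%:R^-1))
        + (n%:R * (1 - c) - (n%:R - 1) / 2) * ln (1 - q))%classic.
Proof.
move=> q0 q1 n0 c0.
rewrite (_ : (fun _ => _) = (fun N =>
  n%:R * (\sum_(0 <= i < N) ln (1 - q * q ^+ i))
  - \sum_(0 <= j < n * N) ln (1 - q `^ c * (q `^ n%:R^-1) ^+ j)
  + (n%:R * (1 - c) - (n%:R - 1) / 2) *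
    (ln (1 - q) - ln (1 - q ^+ N.+1)))); last first.
  apply/funext => N; rewrite euler_ln_grid //; congr (_ * _ - _ + _ * _).
  - by apply: eq_bigr => i _; rewrite /ln_weight powR_mulrn ?exprS // ltW.
  - apply: eq_bigr => j _; rewrite /ln_weight -powR_mulrn ?powR_ge0 // -powRrM.
    by rewrite -powRD ?(gt_eqF q0) ?implybT // [_^-1 * _]mulrC.
  - by rewrite /ln_weight powRr1 ?powR_mulrn // ltW.
have n1 : 0 < (n%:R : R)^-1 by rewrite invr_gt0 ltr0n.
apply: cvgD; first apply: cvgB.
- by apply: cvgM; [exact: cvg_cst|exact: cvg_sum_ln_qpochhammer].
- apply: (cvg_comp (muln n) (fun M =>
    \sum_(0 <= j < M) ln (1 - q `^ c * (q `^ n%:R^-1) ^+ j))).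
    exact: cvg_mulnl.
  by apply: cvg_sum_ln_qpochhammer; rewrite ?powR_gt0 ?powR_lt1.
apply: cvgM; first exact: cvg_cst.
rewrite -[X in (_ --> X)%classic]subr0; apply: cvgB; first exact: cvg_cst.
rewrite -[X in (_ --> X)%classic](@ln1 R).
apply: (@continuous_cvg _ _ _ _ _ (fun N => 1 - q ^+ N.+1) (@ln R)).
  exact: continuous_ln.
rewrite -[X in (_ --> X)%classic]subr0; apply: cvgB; first exact: cvg_cst.
by rewrite (cvg_shiftS (fun N => q ^+ N)); apply: cvg_expr; rewrite gtr0_norm.
Qed.

End QPochhammer.

(** * Wallis's product *)

Section Wallis.
Context {R : realType}.
Implicit Types (x : R) (n N : nat).

(** The antiderivative of [sin ^+ n] vanishing at [0], by the reduction formula.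
    Its value at [pi / 2] is the Wallis integral, and comparing derivatives
    takes the place of comparing integrals. *)
Fixpoint sin_pow_primitive n (x : R) : R :=
  match n with
  | 0 => x
  | 1 => 1 - cos x
  | (m.+1 as m').+1 =>
      (m'%:R * sin_pow_primitive m x - cos x * sin x ^+ m') / m'.+1%:R
  end.

Lemma sin_pow_primitive0 n : sin_pow_primitive n 0 = 0.
Proof.
elim/ltn_ind: n => -[|[|n]] IH //=; first by rewrite cos0 subrr.
by rewrite IH // sin0 expr0n mulr0 mulr0 subrr mul0r.
Qed.

Lemma is_derive_sin_pow_primitive n x :
  is_derive x 1 (sin_pow_primitive n) (sin x ^+ n).
Proof.
elim/ltn_ind: n x => -[|[|n]] IH x.
- exact: is_derive_id.
- by apply: is_derive_eq; rewrite expr1; ring.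
have dn := IH n (leqnSn n.+1) x.
have -> : sin_pow_primitive n.+2 = (fun y =>
    (n.+1%:R * sin_pow_primitive n y - cos y * sin y ^+ n.+1) / n.+2%:R) by [].
have dX : is_derive x 1 (fun y : R => sin y ^+ n.+1)
    (n.+1%:R * sin x ^+ n * cos x).
  have -> : (fun y : R => sin y ^+ n.+1) = (@sin R) ^+ n.+1.
    by apply/funext => y; rewrite exprfctE.
  by apply: is_derive_eq; rewrite /GRing.scale /=.
apply: is_derive_eq; rewrite /GRing.scale /= !exprS.
have c2 : cos x * cos x = 1 - sin x * sin x by rewrite -!expr2 cos2sin2.
have n2 : n.+2%:R != 0 :> R by rewrite pnatr_eq0.
rewrite !mulr0 add0r; apply: (mulfI n2); rewrite mulVKf //.
transitivity (n.+1%:R * sin x ^+ n * (1 - cos x * cos x)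
  + sin x * sin x * sin x ^+ n); first by ring.
by rewrite c2 -[n.+2%:R]natr1; ring.
Qed.

Definition wallis n : R := sin_pow_primitive n (pi / 2).

Lemma wallis1 : wallis 1 = 1.
Proof. by rewrite /wallis /= cos_pihalf subr0. Qed.

Lemma wallisSS n : wallis n.+2 = n.+1%:R / n.+2%:R * wallis n.
Proof. by rewrite /wallis /= cos_pihalf mul0r subr0; ring. Qed.

(** The integrands decrease with [n], as [0 <= sin <= 1] on [[0, pi / 2]]. *)
Lemma wallis_nonincreasing n : wallis n.+1 <= wallis n.
Proof.
rewrite -subr_ge0 /wallis.
pose F y : R := sin_pow_primitive n y - sin_pow_primitive n.+1 y.
have <- : F 0 = 0 by rewrite /F !sin_pow_primitive0 subrr.
have pi2 : (0 : R) <= pi / 2 by rewrite divr_ge0 // pi_ge0.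
apply: (@ge0_is_derive_le R F (fun y => sin y ^+ n - sin y ^+ n.+1)) => // y.
  move=> _; have := is_derive_sin_pow_primitive n y.
  have := is_derive_sin_pow_primitive n.+1 y => ? ?.
  exact: is_deriveB.
move=> /andP[y0 ypi].
have s0 : 0 <= sin y.
  by apply: sin_ge0_pi; rewrite y0 /=; have := pi_ge0 R; lra.
by rewrite subr_ge0 exprS ler_piMl ?exprn_ge0 // sin_le1.
Qed.

Definition central_binomial_ratio N : R :=
  (N.*2)`!%:R / (N`!%:R ^+ 2 * 4 ^+ N).

Lemma central_binomial_ratio_gt0 N : 0 < central_binomial_ratio N.
Proof.
by rewrite /central_binomial_ratio divr_gt0 ?ltr0n ?fact_gt0.
Qed.

Lemma central_binomial_ratioS N : central_binomial_ratio N.+1 =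
  (N.*2).+1%:R / (N.*2).+2%:R * central_binomial_ratio N.
Proof.
rewrite /central_binomial_ratio doubleS !factS !natrM !exprS.
have fact0 : N`!%:R != 0 :> R by rewrite pnatr_eq0 -lt0n fact_gt0.
have -> : (N.*2).+2%:R = 2 * N.+1%:R :> R by rewrite -natrM mul2n doubleS.
by field; rewrite fact0 expf_neq0 ?pnatr_eq0 //= addrC natr1 pnatr_eq0.
Qed.

Lemma wallis_even N : wallis N.*2 = pi / 2 * central_binomial_ratio N.
Proof.
elim: N => [|N IH].
  by rewrite /central_binomial_ratio !fact0 expr1n mul1r expr0 divr1 mulr1.
by rewrite doubleS wallisSS IH central_binomial_ratioS; ring.
Qed.

Lemma wallis_odd N :
  wallis N.*2.+1 = (N.*2.+1%:R * central_binomial_ratio N)^-1.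
Proof.
elim: N => [|N IH].
  rewrite /central_binomial_ratio !fact0 expr1n mul1r expr0 divr1 mulr1.
  by rewrite wallis1 invr1.
rewrite doubleS wallisSS IH central_binomial_ratioS.
have ? := lt0r_neq0 (central_binomial_ratio_gt0 N).
by field; rewrite -!natrD !pnatr_eq0; apply/and4P; split.
Qed.

End Wallis.

(** * Stirling's formula *)

Section Stirling.
Context {R : realType}.
Implicit Types (s x : R) (n N : nat).

(** The difference has derivative [(y - 1)^2 / (y (y + 1)^2)]. *)
Lemma ln_ge_pade s : 1 <= s -> 2 * (s - 1) / (s + 1) <= ln s.
Proof.
move=> s1; rewrite -subr_ge0.
pose F y : R := ln y - 2 * (y - 1) / (y + 1).
have <- : F 1 = 0 by rewrite /F ln1 subrr mulr0 mul0r subrr.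
apply: (@ge0_is_derive_le R F (fun y => y^-1 - 4 / (y + 1) ^+ 2)) => // y.
  move=> /andP[y1 _]; have y0 : 0 < y by lra.
  have dl := @is_derive1_ln R y y0.
  have yN0 : y + 1 != 0 by rewrite gt_eqF //; lra.
  have dy : is_derive y 1 (fun z : R => z + 1) 1.
    by apply: is_derive_eq; rewrite addr0.
  have dV := @is_deriveV R (fun z : R => z + 1) y _ 1 yN0 dy.
  by apply: is_derive_eq; rewrite /GRing.scale /=; field; rewrite yN0 gt_eqF.
move=> /andP[y1 _]; have y0 : 0 < y by lra.
have -> : y^-1 - 4 / (y + 1) ^+ 2 = (y - 1) ^+ 2 / (y * (y + 1) ^+ 2).
  by field; rewrite !gt_eqF //; lra.
by rewrite divr_ge0 ?sqr_ge0 // mulr_ge0 ?sqr_ge0 // ltW.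
Qed.

(** The difference has derivative [(1 - 1 / y)^2 / 2]. *)
Lemma ln_le_sub_inv s : 1 <= s -> ln s <= (s - s^-1) / 2.
Proof.
move=> s1; rewrite -subr_ge0.
pose F y : R := (y - y^-1) / 2 - ln y.
have <- : F 1 = 0 by rewrite /F ln1 invr1 subrr mul0r subrr.
apply: (@ge0_is_derive_le R F (fun y => (1 - y^-1) ^+ 2 / 2)) => // y.
  move=> /andP[y1 _]; have y0 : 0 < y by lra.
  have dl := @is_derive1_ln R y y0.
  have dV := @is_deriveV R id y 1 1 (lt0r_neq0 y0) (is_derive_id _ _).
  by apply: is_derive_eq; rewrite /GRing.scale /=; field; rewrite gt_eqF.
by rewrite divr_ge0 ?sqr_ge0.
Qed.

Definition stirling_error N : R :=
  ln N`!%:R - (N%:R + 1 / 2) * ln N%:R + N%:R.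

Lemma stirling_errorB N : (0 < N)%N ->
  stirling_error N - stirling_error N.+1 =
  (N%:R + 1 / 2) * ln (N.+1%:R / N%:R) - 1.
Proof.
move=> N0; rewrite /stirling_error factS natrM lnM ?posrE ?ltr0n ?fact_gt0 //.
by rewrite ln_div ?posrE ?ltr0n // -!natr1; ring.
Qed.

(** The two bounds on [ln] at [(N + 1) / N], multiplied by [N + 1 / 2], are
    exactly [1] and [1 + 1 / (4 N (N + 1))]; the excess telescopes. *)
Lemma stirling_error_step N : (0 < N)%N ->
  0 <= stirling_error N - stirling_error N.+1 <= (N%:R^-1 - N.+1%:R^-1) / 4.
Proof.
move=> N0; have x0 : 0 < N%:R :> R by rewrite ltr0n.
rewrite stirling_errorB // -[N.+1%:R]natr1; set x : R := N%:R in x0 *.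
have s1 : 1 <= (x + 1) / x by rewrite ler_pdivlMr // mul1r lerDl.
have h0 : 0 <= x + 1 / 2 by lra.
apply/andP; split.
  rewrite subr_ge0; apply: le_trans _ (ler_wpM2l h0 (ln_ge_pade s1)).
  rewrite le_eqVlt; apply/orP; left; apply/eqP.
  by field; rewrite !gt_eqF //; lra.
rewrite lerBlDr; apply: le_trans (ler_wpM2l h0 (ln_le_sub_inv s1)) _.
rewrite le_eqVlt; apply/orP; left; apply/eqP.
by field; rewrite !gt_eqF //; lra.
Qed.

Lemma is_cvg_stirling_error : cvgn stirling_error.
Proof.
suff /cvg_ex[l] : cvgn (fun N => stirling_error N.+1).
  by rewrite (cvg_shiftS stirling_error) => el; apply/cvg_ex; exists l.
(* The value at [N = 0] is meaningless, as [ln 0 = 0] there. *)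
apply: nonincreasing_is_cvgn.
  apply/nonincreasing_seqP => N; rewrite -subr_ge0.
  by case/andP: (stirling_error_step (ltn0Sn N)).
exists (stirling_error 1 - 1 / 4) => _ [N _ <-].
suff : stirling_error 1 - 1 / 4 + N.+1%:R^-1 / 4 <= stirling_error N.+1.
  by apply: le_trans; rewrite lerDl divr_ge0.
elim: N => [|N IH]; first by rewrite invr1; lra.
have /andP[_] := stirling_error_step (ltn0Sn N).
move: IH; set x := N.+1%:R^-1; set y := N.+2%:R^-1; lra.
Qed.

(** Wallis's sandwich: [W_(2N+2) <= W_(2N+1) <= W_(2N)], where the even terms
    are proportional to the ratio and the odd ones to its inverse. *)
Lemma central_binomial_ratio_bounds N : (0 < N)%N ->
  (1 + (N.*2)%:R^-1)^-1 <= N%:R * pi * (central_binomial_ratio N : R) ^+ 2 <= 1.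
Proof.
move=> N0; have x0 : 0 < N%:R :> R by rewrite ltr0n.
have u0 := @central_binomial_ratio_gt0 R N.
have := @wallis_nonincreasing R N.*2; have := @wallis_nonincreasing R N.*2.+1.
rewrite wallisSS wallis_odd wallis_even.
rewrite -[N.*2.+2%:R]natr1 -[N.*2.+1%:R]natr1 -mul2n natrM.
move: u0 x0; set u := central_binomial_ratio N; set x : R := N%:R => u0 x0.
have pi0 := @pi_gt0 R.
have d0 : 0 < (2 * x + 1) * u by rewrite mulr_gt0 //; lra.
rewrite -[X in _ <= X -> _]div1r -[X in _ -> X <= _ -> _]div1r.
rewrite ler_pdivlMr // ler_pdivrMr // => up lo; apply/andP; split.
  have -> : (1 + (2 * x)^-1)^-1 = 2 * x / (2 * x + 1).
    by field; rewrite !gt_eqF //; lra.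
  rewrite ler_pdivrMr; last by lra.
  rewrite (_ : x * pi * u ^+ 2 * (2 * x + 1) =
    2 * x * (pi / 2 * u * ((2 * x + 1) * u))); last by field.
  by rewrite ler_peMr //; lra.
apply: le_trans up.
rewrite (_ : (2 * x + 1) / _ * _ * _ =
  x * pi * u ^+ 2 * ((2 * x + 1) ^+ 2 / (2 * x * (2 * x + 1 + 1)))); last first.
  by field; rewrite !gt_eqF //; lra.
rewrite ler_peMr ?mulr_ge0 ?sqr_ge0 ?(ltW pi0) ?(ltW x0) //.
rewrite ler_pdivlMr ?mulr_gt0 //; last by lra.
by rewrite mul1r -subr_ge0 (_ : _ - _ = 1) //; ring.
Qed.

End Stirling.

(** * Limits of the Euler products for Gamma *)

Section Limits.
Context {R : realType}.
Implicit Types (x : R) (n N : nat).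

Lemma cvg_ln_central_binomial_ratio :
  ((fun N => ln (N.+1%:R : R) + 2 * ln (central_binomial_ratio N.+1)) @ \oo
    --> - ln (pi : R))%classic.
Proof.
have pi0 := @pi_gt0 R.
(* [t N] is the logarithm of the middle term of the Wallis bounds. *)
pose t N : R := ln (N.+1%:R) + ln pi + 2 * ln (central_binomial_ratio N.+1).
have tE N : t N = ln (N.+1%:R * pi * central_binomial_ratio N.+1 ^+ 2).
  have u0 := @central_binomial_ratio_gt0 R N.+1.
  have x0 : 0 < N.+1%:R :> R by rewrite ltr0n.
  rewrite lnM ?posrE ?exprn_gt0 ?mulr_gt0 // lnM ?posrE //.
  by rewrite lnXn // /t mulr_natl.
have t0 : (t @ \oo --> (0 : R))%classic.
  apply: (@squeeze_cvgr _ _ _ _ (fun N => - @harmonic R N) (fun=> 0)).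
  - apply: nearW => N; rewrite tE.
    have /andP[lo up] := @central_binomial_ratio_bounds R N.+1 (ltn0Sn N).
    have y0 : 0 < (N.+1.*2)%:R^-1 :> R by rewrite invr_gt0 ltr0n double_gt0.
    have z0 : 0 < (1 + (N.+1.*2)%:R^-1)^-1 :> R.
      by rewrite invr_gt0 addr_gt0.
    rewrite ln_le0 // andbT.
    apply: (@le_trans _ _ (ln (1 + (N.+1.*2)%:R^-1)^-1)); last first.
      by rewrite ler_ln // posrE (lt_le_trans z0).
    rewrite lnV ?posrE ?addr_gt0 // lerN2; apply: le_trans (le_ln1Dx _) _.
      by rewrite (lt_trans _ y0).
    by rewrite /harmonic /= lef_pV2 ?posrE ?ltr0n ?double_gt0 //
      ler_nat -addnn leq_addr.
  - by rewrite -[X in (_ --> X)%classic]oppr0; apply: cvgN; exact: cvg_harmonic.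
  - exact: cvg_cst.
rewrite (_ : (fun _ => _) = (fun N => t N - ln pi)).
  by rewrite -[X in (_ --> X)%classic]add0r; apply: cvgB => //; exact: cvg_cst.
by apply/funext => N; rewrite /t; ring.
Qed.

(** Inserting Stirling's formula with unknown limit [l] into the central
    binomial coefficient leaves [- l] in the limit, which Wallis's product
    determines. *)
Lemma cvg_stirling_error :
  (@stirling_error R @ \oo --> ln (2 * pi : R) / 2)%classic.
Proof.
have [l el] : exists l : R, (@stirling_error R @ \oo --> l)%classic.
  exact/cvg_ex/is_cvg_stirling_error.
suff -> : ln (2 * pi : R) / 2 = l by [].
have e2l : ((fun N => @stirling_error R (2 * N)) @ \oo --> l)%classic.
  apply: (cvg_comp (muln 2) (@stirling_error R)); last exact: el.
  exact: cvg_mulnl.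
have cl : ((fun N => ln (N.+1%:R : R) + 2 * ln (central_binomial_ratio N.+1))
    @ \oo --> 2 * (l - 2 * l) + ln 2)%classic.
  rewrite (_ : (fun _ => _) = (fun N =>
    2 * (stirling_error (2 * N.+1) - 2 * stirling_error N.+1) + ln 2)).
    apply: cvgD; last exact: cvg_cst.
    apply: cvgM; first exact: cvg_cst.
    apply: cvgB.
      by rewrite (cvg_shiftS (fun N => stirling_error (2 * N))).
    apply: cvgM; first exact: cvg_cst.
    by rewrite (cvg_shiftS stirling_error).
  apply/funext => N; rewrite /stirling_error /central_binomial_ratio -mul2n.
  have f0 M : 0 < M`!%:R :> R by rewrite ltr0n fact_gt0.
  rewrite ln_div ?posrE ?mulr_gt0 ?exprn_gt0 // lnM ?posrE ?exprn_gt0 //.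
  rewrite !lnXn // natrM lnM ?posrE ?ltr0n //.
  have -> : ln (4 : R) = 2 * ln 2.
    by rewrite (_ : 4 = 2 ^+ 2) ?lnXn ?mulr_natl // -natrX.
  by rewrite -[2 * ln 2 *+ _]mulr_natl -[ln _ *+ 2]mulr_natl; field.
have lE : 2 * (l - 2 * l) + ln 2 = - ln pi.
  exact: cvg_unique cl cvg_ln_central_binomial_ratio.
rewrite lnM ?posrE ?pi_gt0 //; move: lE.
set a := ln 2; set b := ln pi => lE.
lra.
Qed.

Lemma cvg_ln_ratio x : 0 <= x -> x <= 1 ->
  ((fun N => ln (N.+2%:R : R) - ln (N.+1%:R + x)) @ \oo --> (0 : R))%classic.
Proof.
move=> x0 x1; apply: (@squeeze_cvgr _ _ _ _ (fun=> 0) (@harmonic R)).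
- apply: nearW => N; have M0 : 0 < N.+1%:R :> R by rewrite ltr0n.
  rewrite -[N.+2%:R]natr1 /harmonic /=; move: (N.+1%:R : R) M0 => M M0.
  have Mx0 : 0 < M + x by rewrite ltr_wpDr.
  have M10 : 0 < M + 1 by rewrite addr_gt0.
  rewrite subr_ge0 ler_ln ?posrE // lerD2l x1 /=.
  rewrite -ln_div ?posrE //.
  have -> : (M + 1) / (M + x) = 1 + (1 - x) / (M + x).
    by field; rewrite gt_eqF.
  have y0 : 0 <= (1 - x) / (M + x) by rewrite divr_ge0 ?subr_ge0 // ltW.
  apply: le_trans (le_ln1Dx _) _; first exact: lt_le_trans y0.
  rewrite -[leRHS]mul1r ler_pM ?subr_ge0 ?invr_ge0 ?(ltW Mx0) //.
    by rewrite gerBl.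
  by rewrite lef_pV2 ?posrE // lerDl.
- exact: cvg_cst.
- exact: cvg_harmonic.
Qed.

Lemma sum_ln_grid n K : (0 < n)%N ->
  \sum_(0 <= j < K) ln (n%:R^-1 + j%:R / n%:R) =
  ln K`!%:R - K%:R * ln n%:R :> R.
Proof.
move=> n0; elim: K => [|K IH].
  by rewrite big_geq // fact0 ln1 mul0r subr0.
have n0' : 0 < n%:R :> R by rewrite ltr0n.
rewrite big_nat_recr //= IH factS natrM lnM ?posrE ?ltr0n ?fact_gt0 //.
have -> : n%:R^-1 + K%:R / n%:R = K.+1%:R / n%:R :> R by rewrite -natr1; ring.
by rewrite ln_div ?posrE ?ltr0n // -natr1; ring.
Qed.

(** Gauss's multiplication formula for the product of [Gamma (k / n)]: the
    terms [N ln N], [N] and [N ln n] of Stirling's formula for [n ln N!] and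
    [ln (n N)!] cancel. *)
Lemma cvg_euler_ln_ln_grid n : (0 < n)%N ->
  ((fun N => \sum_(0 <= k < n) euler_ln (@ln R) N (n%:R^-1 + k%:R / n%:R)) @ \oo
    --> (n%:R - 1) / 2 * ln (2 * pi) - ln n%:R / 2)%classic.
Proof.
move=> n0; have n0' : 0 < n%:R :> R by rewrite ltr0n.
(* Splitting [ln (n * N)] requires [0 < N]. *)
rewrite -cvg_shiftS /=.
rewrite (_ : (fun _ => _) = (fun N : nat =>
  n%:R * stirling_error N.+1 - stirling_error (n * N.+1) - ln n%:R / 2
  - (n%:R - 1) / 2 * (ln N.+2%:R - ln (N.+1%:R + 0)))); last first.
  apply/funext => N; rewrite euler_ln_grid // sum_ln_grid //.
  have -> : \sum_(0 <= i < N.+1) ln i.+1%:R = ln (N.+1)`!%:R :> R.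
    have := sum_ln_grid N.+1 (ltn0Sn 0).
    rewrite ln1 mulr0 subr0 => <-; apply: eq_bigr => i _.
    by rewrite invr1 mulr1 addrC natr1.
  rewrite /stirling_error natrM lnM ?posrE ?ltr0n // ln1 addr0.
  by field; rewrite gt_eqF.
have -> : (n%:R - 1) / 2 * ln (2 * pi) - ln n%:R / 2 =
    n%:R * (ln (2 * pi) / 2) - ln (2 * pi) / 2 - ln n%:R / 2
    - (n%:R - 1) / 2 * 0 :> R by field.
apply: cvgB; first (apply: cvgB; [apply: cvgB|exact: cvg_cst]).
- apply: cvgM; first exact: cvg_cst.
  by rewrite (cvg_shiftS stirling_error); exact: cvg_stirling_error.
- rewrite (cvg_shiftS (fun N => stirling_error (n * N))).
  apply: (cvg_comp (muln n) (@stirling_error R)); first exact: cvg_mulnl.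
  exact: cvg_stirling_error.
- by apply: cvgM; [exact: cvg_cst|exact: cvg_ln_ratio].
Qed.

(** The finite form of [Gamma (x + 1) = (w x / w 1) * Gamma x], where
    [w = exp f]. *)
Lemma euler_lnD1 (f : R -> R) N x :
  euler_ln f N (1 + x) =
  euler_ln f N x + f x - f (N%:R + x) - (f 1 - f N.+1%:R).
Proof.
rewrite /euler_ln.
suff -> : \sum_(0 <= i < N) (f i.+1%:R - f (i%:R + (1 + x))) =
    \sum_(0 <= i < N) (f i.+1%:R - f (i%:R + x)) + f x - f (N%:R + x) by ring.
elim: N => [|N IH]; first by rewrite !big_geq // mulr0n !add0r subrr.
rewrite !big_nat_recr //= IH -natr1 !addrA; ring.
Qed.

(** The factors [k / n] gained from [Gamma (1 + k / n) = (k / n) Gamma (k / n)]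
    multiply to [(n - 1)! / n^(n - 1)]. *)
Lemma cvg_euler_ln_ln_grid1 n : (0 < n)%N ->
  ((fun N => \sum_(0 <= k < n) euler_ln (@ln R) N (1 + k%:R / n%:R)) @ \oo
    --> (n%:R - 1) / 2 * ln (2 * pi) - ln n%:R / 2
        + (ln (n.-1)`!%:R - (n%:R - 1) * ln n%:R))%classic.
Proof.
case: n => // n _; have n0' : 0 < n.+1%:R :> R by rewrite ltr0n.
have xE k : n.+1%:R^-1 + k%:R / n.+1%:R = k.+1%:R / n.+1%:R :> R.
  by rewrite -[k.+1%:R]natr1; ring.
rewrite -cvg_shiftS /=.
rewrite (_ : (fun _ => _) = (fun N : nat =>
  \sum_(0 <= k < n.+1) euler_ln (@ln R) N.+1 (n.+1%:R^-1 + k%:R / n.+1%:R)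
  + (\sum_(0 <= k < n) ln (n.+1%:R^-1 + k%:R / n.+1%:R)
     + \sum_(0 <= k < n)
      (ln N.+2%:R - ln (N.+1%:R + k.+1%:R / n.+1%:R))))); last first.
  apply/funext => N; rewrite big_nat_recl // [in RHS]big_nat_recr //=.
  rewrite xE divff ?gt_eqF // mul0r addr0 [LHS]addrC [RHS]addrAC; congr (_ + _).
  rewrite -!big_split /=; apply: eq_bigr => k _.
  by rewrite euler_lnD1 ln1 xE; ring.
apply: cvgD.
  rewrite (cvg_shiftS (fun N => \sum_(0 <= k < n.+1)
    euler_ln (@ln R) N (n.+1%:R^-1 + k%:R / n.+1%:R))).
  exact: cvg_euler_ln_ln_grid.
rewrite sum_ln_grid // /= -[n.+1%:R - 1](_ : n%:R = _); last first.
  by rewrite -natr1 addrK.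
rewrite -[X in (_ --> X)%classic]addr0; apply: cvgD; first exact: cvg_cst.
have nR k : (k < n)%N -> k.+1%:R / n.+1%:R <= 1 :> R.
  by move=> kn; rewrite ler_pdivrMr // mul1r ler_nat; exact: leqW.
have sum0 : \sum_(0 <= k < n | (0 <= k < n)%N) 0 = 0 :> R by rewrite big1.
rewrite -[X in (_ --> X)%classic]sum0.
under eq_cvg do rewrite big_nat.
apply: cvg_big => [|k /andP[_ kn]]; first exact: add_continuous.
by apply: cvg_ln_ratio; [rewrite divr_ge0|exact: nR].
Qed.

End Limits.

(** * Comparison and conclusion *)

Section Comparison.
Context {R : realType}.
Implicit Types (f g : R -> R) (p q : R) (N n : nat).

Lemma ler_sum_euler_ln f g N n : (0 < n)%N ->
  chord_convex (fun u => f u - g u) ->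
  \sum_(0 <= k < n) euler_ln f N (n%:R^-1 + k%:R / n%:R) <=
  \sum_(0 <= k < n) euler_ln g N (n%:R^-1 + k%:R / n%:R).
Proof.
move=> n0 cD; have n0' : 0 < n%:R :> R by rewrite ltr0n.
apply: ler_sum_nat => k /andP[_ kn]; rewrite -subr_le0 -euler_lnB.
have -> : n%:R^-1 + k%:R / n%:R = k.+1%:R / n%:R :> R by rewrite -natr1; ring.
apply: euler_ln_le0 => //; first by rewrite divr_gt0.
by rewrite ler_pdivrMr // mul1r ler_nat.
Qed.

Lemma ger_sum_euler_ln f g N n : (0 < n)%N ->
  chord_convex (fun u => f u - g u) ->
  \sum_(0 <= k < n) euler_ln g N (1 + k%:R / n%:R) <=
  \sum_(0 <= k < n) euler_ln f N (1 + k%:R / n%:R).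
Proof.
move=> n0 cD; have n0' : 0 < n%:R :> R by rewrite ltr0n.
apply: ler_sum_nat => k /andP[_ kn]; rewrite -subr_ge0 -euler_lnB.
apply: euler_ln_ge0 => //; first by rewrite lerDl divr_ge0.
rewrite -[leRHS]/(1 + 1) lerD2l ler_pdivrMr // mul1r ler_nat.
exact: ltnW.
Qed.

Lemma expR_ln_qpochhammer_ratio q a r e n :
  0 < q -> q < 1 -> 0 < a -> a < 1 -> 0 < r -> r < 1 ->
  expR (n%:R * ln (qpochhammer q q) - ln (qpochhammer a r) + e * ln (1 - q)) =
  qpochhammer q q ^+ n / qpochhammer a r * (1 - q) `^ e.
Proof.
move=> q0 q1 a0 a1 r0 r1.
rewrite expRD expRB expRM_natl !lnK ?posrE ?qpochhammer_gt0 //.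
by rewrite /powR gt_eqF // subr_gt0.
Qed.

End Comparison.

Theorem theorem13 (R : realType) (p q : R) (n : nat)
    (hp : 0 < p) (hpq : p < q) (hq : q < 1) (hn : (1 < n)%N) :
  (qpochhammer p p ^+ n / qpochhammer (p `^ n%:R^-1) (p `^ n%:R^-1)
       * (1 - p) `^ ((n%:R - 1) / 2)
     <= qpochhammer q q ^+ n / qpochhammer (q `^ n%:R^-1) (q `^ n%:R^-1)
       * (1 - q) `^ ((n%:R - 1) / 2)
     <= (2 * pi) `^ ((n%:R - 1) / 2) / Num.sqrt n%:R)
  /\
  (((n.-1)`!)%:R * (2 * pi) `^ ((n%:R - 1) / 2) / n%:R `^ (n%:R - 1 / 2)
     <= qpochhammer q q ^+ n / qpochhammer q (q `^ n%:R^-1)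
       * (1 / (1 - q) `^ ((n%:R - 1) / 2))
     <= qpochhammer p p ^+ n / qpochhammer p (p `^ n%:R^-1)
       * (1 / (1 - p) `^ ((n%:R - 1) / 2))).
Proof.
have n0 : (0 < n)%N := ltnW hn.
have n0' : 0 < n%:R :> R by rewrite ltr0n.
have nV0 : 0 < n%:R^-1 :> R by rewrite invr_gt0.
have q0 := lt_trans hp hpq; have p1 := lt_trans hpq hq.
have tau0 : 0 < 2 * pi :> R by rewrite mulr_gt0 // pi_gt0.
have convpq := ln_weightB_chord_convex hp hpq hq.
have convq := ln_weightBln_chord_convex q0 hq.
have eV : n%:R * (1 - n%:R^-1) - (n%:R - 1) / 2 = (n%:R - 1) / 2 :> R.
  by field; rewrite gt_eqF.
have e1 : n%:R * (1 - 1) - (n%:R - 1) / 2 = - ((n%:R - 1) / 2) :> R by ring.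
have limV r (r0 : 0 < r) (r1 : r < 1) := cvg_euler_ln_weight_grid r0 r1 n0 nV0.
have lim1 r (r0 : 0 < r) (r1 : r < 1) :=
  @cvg_euler_ln_weight_grid R r n 1 r0 r1 n0 ltr01.
rewrite eV in limV; rewrite e1 in lim1.
have ratioV (r : R) : 0 < r -> r < 1 ->
    qpochhammer r r ^+ n / qpochhammer (r `^ n%:R^-1) (r `^ n%:R^-1)
      * (1 - r) `^ ((n%:R - 1) / 2) = expR (n%:R * ln (qpochhammer r r)
      - ln (qpochhammer (r `^ n%:R^-1) (r `^ n%:R^-1))
      + (n%:R - 1) / 2 * ln (1 - r)).
  by move=> r0 r1; rewrite expR_ln_qpochhammer_ratio ?powR_gt0 ?powR_lt1.
have ratio1 (r : R) : 0 < r -> r < 1 ->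
    qpochhammer r r ^+ n / qpochhammer r (r `^ n%:R^-1)
      * (1 / (1 - r) `^ ((n%:R - 1) / 2)) = expR (n%:R * ln (qpochhammer r r)
      - ln (qpochhammer (r `^ 1) (r `^ n%:R^-1))
      + - ((n%:R - 1) / 2) * ln (1 - r)).
  move=> r0 r1; rewrite expR_ln_qpochhammer_ratio ?powR_gt0 ?powR_lt1 //.
  by rewrite powRr1 ?(ltW r0) // powRN div1r.
have constV : (2 * pi) `^ ((n%:R - 1) / 2) / Num.sqrt n%:R =
    expR ((n%:R - 1) / 2 * ln (2 * pi) - ln n%:R / 2) :> R.
  rewrite expRB -powR12_sqrt ?(ltW n0') // /powR !gt_eqF //.
  by rewrite [2^-1 * _]mulrC.
have const1 : ((n.-1)`!)%:R * (2 * pi) `^ ((n%:R - 1) / 2)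
      / n%:R `^ (n%:R - 1 / 2) =
    expR ((n%:R - 1) / 2 * ln (2 * pi) - ln n%:R / 2
      + (ln (n.-1)`!%:R - (n%:R - 1) * ln n%:R)) :> R.
  rewrite /powR !gt_eqF //.
  rewrite -[in LHS](@lnK R (n.-1)`!%:R) ?posrE ?ltr0n ?fact_gt0 //.
  by rewrite -expRD -expRB; congr expR; field.
split; apply/andP; split.
- rewrite [leLHS](ratioV p hp p1) [leRHS](ratioV q q0 hq) ler_expR.
  apply: ler_cvg_to (limV p hp p1) (limV q q0 hq) _.
  by apply: nearW => N; exact: ler_sum_euler_ln.
- rewrite [leLHS](ratioV q q0 hq) [leRHS]constV ler_expR.
  apply: ler_cvg_to (limV q q0 hq) (cvg_euler_ln_ln_grid n0) _.
  by apply: nearW => N; exact: ler_sum_euler_ln.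
- rewrite [leLHS]const1 [leRHS](ratio1 q q0 hq) ler_expR.
  apply: ler_cvg_to (cvg_euler_ln_ln_grid1 n0) (lim1 q q0 hq) _.
  by apply: nearW => N; exact: ger_sum_euler_ln.
- rewrite [leLHS](ratio1 q q0 hq) [leRHS](ratio1 p hp p1) ler_expR.
  apply: ler_cvg_to (lim1 q q0 hq) (lim1 p hp p1) _.
  by apply: nearW => N; exact: ger_sum_euler_ln.
Qed.
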